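(* Let $V_1,V_2,V_3$ be $2$-dimensional complex vector spaces, each with a fixed basis $e_1,e_2$, and let $$W = e_1 \otimes e_1 \otimes e_2 + e_1 \otimes e_2 \otimes e_1 + e_2 \otimes e_1 \otimes e_1 \in V_1 \otimes V_2 \otimes V_3.$$ Let $k,p\ge1$ be integers. For the $k$-th Kronecker power $W^{\boxtimes k} \in V_1^{\otimes k} \otimes V_2^{\otimes k} \otimes V_3^{\otimes k}$ it holds that $$R^{\blacksquare p}(W^{\boxtimes k}) = 2^k \text{ if } p \geq 2^k, \qquad R^{\blacksquare p}(W^{\boxtimes k}) > 2^k \text{ if } p < 2^k.$$
   Context: A tensor $T \in U_1 \otimes U_2 \otimes U_3$ restricts to $S \in V_1\otimes V_2\otimes V_3$, written $T\ge S$, if there are linear maps $A_i: U_i\to V_i$ ($i=1,2,3$) with $S=(A_1\otimes A_2\otimes A_3)T$. The unit tensor is $\langle r \rangle = \sum_{i=1}^r e_i\otimes e_i\otimes e_i\in\mathbb{C}^r\otimes\mathbb{C}^r\otimes\mathbb{C}^r$. The Kronecker product $T\boxtimes S\in(U_1\otimes V_1)\otimes(U_2\otimes V_2)\otimes(U_3\otimes V_3)$ of $T=\sum T_{i_1i_2i_3}e_{i_1}\otimes e_{i_2}\otimes e_{i_3}$ and $S=\sum S_{j_1j_2j_3}e_{j_1}\otimes e_{j_2}\otimes e_{j_3}$ is $\sum T_{i_1i_2i_3}S_{j_1j_2j_3}(e_{i_1}\otimes e_{j_1})\otimes(e_{i_2}\otimes e_{j_2})\otimes(e_{i_3}\otimes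 e_{j_3})$; $W^{\boxtimes k}$ is the $k$-fold Kronecker product of $W$ with itself. For $p\ge 1$, $T^{\blacksquare p} = T\boxtimes\langle 1,1,p\rangle\in U_1\otimes(U_2\otimes\mathbb{C}^p)\otimes(U_3\otimes\mathbb{C}^p)$, where $\langle 1,1,p\rangle = e_1\otimes\sum_{l=1}^p e_l\otimes e_l \in \mathbb{C}^1\otimes\mathbb{C}^p\otimes\mathbb{C}^p$. The $p$-th aided rank of a tensor $S$ is $R^{\blacksquare p}(S)=\min\{r:\langle r\rangle^{\blacksquare p}\ge S\}$. *)

(* Defs.v *)
From HB Require Import structures.
From mathcomp Require Import all_boot all_order all_algebra.
From mathcomp Require Import boolp reals complex.

Set Implicit Arguments.
Unset Strict Implicit.
Unset Printing Implicit Defensive.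

Import GRing.Theory.
Local Open Scope ring_scope.

(* Vector spaces are taken with a fixed basis, indexed by a finite type [I].
   The regular module [F^o] gives [{ffun I -> F^o}] its [lmodType F] structure. *)
Definition vec (F : fieldType) (I : finType) := {ffun I -> F^o}.

(* [U1 (x) U2 (x) U3], by coordinates in the product basis. *)
Definition tensor (F : fieldType) (I1 I2 I3 : finType) :=
  {ffun I1 * I2 * I3 -> F^o}.

Definition bvec (F : fieldType) (I : finType) (i : I) : vec F I :=
  [ffun i' => (i' == i)%:R].

Definition tprod (F : fieldType) (I1 I2 I3 : finType)
    (u : vec F I1) (v : vec F I2) (w : vec F I3) : tensor F I1 I2 I3 :=
  [ffun x => u x.1.1 * v x.1.2 * w x.2].

(* [(A1 (x) A2 (x) A3) T], by trilinear extension from the basis tensors. *)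
Definition tmap (F : fieldType) (I1 I2 I3 J1 J2 J3 : finType)
    (A1 : {linear vec F I1 -> vec F J1}) (A2 : {linear vec F I2 -> vec F J2})
    (A3 : {linear vec F I3 -> vec F J3}) (T : tensor F I1 I2 I3) :
    tensor F J1 J2 J3 :=
  \sum_(x : I1 * I2 * I3)
    T x *: tprod (A1 (bvec F x.1.1)) (A2 (bvec F x.1.2)) (A3 (bvec F x.2)).

Definition restricts (F : fieldType) (I1 I2 I3 J1 J2 J3 : finType)
    (T : tensor F I1 I2 I3) (S : tensor F J1 J2 J3) : Prop :=
  exists (A1 : {linear vec F I1 -> vec F J1})
         (A2 : {linear vec F I2 -> vec F J2})
         (A3 : {linear vec F I3 -> vec F J3}), S = tmap A1 A2 A3 T.

Definition unit_tensor (F : fieldType) (r : nat) : tensor F 'I_r 'I_r 'I_r :=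
  \sum_(i < r) tprod (bvec F i) (bvec F i) (bvec F i).

Definition kron (F : fieldType) (I1 I2 I3 J1 J2 J3 : finType)
    (T : tensor F I1 I2 I3) (S : tensor F J1 J2 J3) :
    tensor F (I1 * J1)%type (I2 * J2)%type (I3 * J3)%type :=
  [ffun x => T (x.1.1.1, x.1.2.1, x.2.1) * S (x.1.1.2, x.1.2.2, x.2.2)].

(* Basis index set of the [k]-th tensor power [U (x) (U (x) ... (U (x) F))]. *)
Fixpoint ipow (I : finType) (k : nat) : finType :=
  if k is k'.+1 then (I * ipow I k')%type else unit.

Fixpoint kron_pow (F : fieldType) (I1 I2 I3 : finType)
    (T : tensor F I1 I2 I3) (k : nat) :
    tensor F (ipow I1 k) (ipow I2 k) (ipow I3 k) :=
  if k is k'.+1 then kron T (kron_pow T k')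
  else tprod (bvec F tt) (bvec F tt) (bvec F tt).

(* The matrix multiplication tensor [<1,1,p>]. *)
Definition mamu11 (F : fieldType) (p : nat) : tensor F 'I_1 'I_p 'I_p :=
  \sum_(l < p) tprod (bvec F ord0) (bvec F l) (bvec F l).

Definition aid (F : fieldType) (I1 I2 I3 : finType)
    (p : nat) (T : tensor F I1 I2 I3) :
    tensor F (I1 * 'I_1)%type (I2 * 'I_p)%type (I3 * 'I_p)%type :=
  kron T (mamu11 F p).

Definition aided_le (F : fieldType) (I1 I2 I3 : finType)
    (p : nat) (S : tensor F I1 I2 I3) (r : nat) : Prop :=
  restricts (aid p (unit_tensor F r)) S.

(* The default value [0] is only reached when [p = 0]: see [aided_rankP]. *)
Definition aided_rank (F : fieldType) (I1 I2 I3 : finType)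
    (p : nat) (S : tensor F I1 I2 I3) : nat :=
  if pselect (exists r, `[< aided_le p S r >]) is left exr then ex_minn exr
  else 0%N.

Definition W (F : fieldType) : tensor F 'I_2 'I_2 'I_2 :=
  let e1 := bvec F (0 : 'I_2) in
  let e2 := bvec F (1 : 'I_2) in
  tprod e1 e1 e2 + tprod e1 e2 e1 + tprod e2 e1 e1.

Lemma bvec_sum (F : fieldType) (I : finType) (u : I -> F) (i : I) :
  \sum_j bvec F i j * u j = u i.
Proof.
rewrite (bigD1 i) //= big1 => [|j ji]; first by rewrite ffunE eqxx mul1r addr0.
by rewrite ffunE (negbTE ji) mul0r.
Qed.

Lemma linear_from_basis (F : fieldType) (I J : finType) (w : I -> vec F J) :
  exists A : {linear vec F I -> vec F J}, forall i, A (bvec F i) = w i.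
Proof.
pose f (v : vec F I) : vec F J := \sum_i (v i : F) *: w i.
have f_lin : linear f.
  move=> a u v; rewrite /f scaler_sumr -big_split /=; apply: eq_bigr => i _.
  by rewrite !ffunE scalerDl scalerA.
pose A : {linear vec F I -> vec F J} :=
  HB.pack f (GRing.isLinear.Build F (vec F I) (vec F J) *:%R f f_lin).
exists A => i; apply/ffunP => j; rewrite /A /= /f sum_ffunE.
rewrite -(bvec_sum (fun i => w i j) i).
by apply: eq_bigr => k _; rewrite !ffunE.
Qed.

Lemma unit_tensorE (F : fieldType) (r : nat) (x : 'I_r * 'I_r * 'I_r) :
  unit_tensor F r x = ((x.1.2 == x.1.1) && (x.2 == x.1.1))%:R.
Proof.
rewrite /unit_tensor sum_ffunE.
rewrite -(bvec_sum (fun i => ((x.1.2 == i) && (x.2 == i))%:R) x.1.1).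
apply: eq_bigr => i _; rewrite !ffunE -mulrA eq_sym; congr (_ * _).
by case: (_ == _); case: (_ == _); rewrite ?mulr0 ?mul0r ?mulr1.
Qed.

Lemma mamu11E (F : fieldType) (p : nat) (x : 'I_1 * 'I_p * 'I_p) :
  mamu11 F p x = (x.1.2 == x.2)%:R.
Proof.
rewrite /mamu11 sum_ffunE -(bvec_sum (fun i => (x.1.2 == i)%:R) x.2).
apply: eq_bigr => i _; rewrite !ffunE !ord1 eqxx mul1r mulrC eq_sym.
by rewrite (eq_sym i).
Qed.

Lemma aided_le_exists (F : fieldType) (I1 I2 I3 : finType)
    (p : nat) (S : tensor F I1 I2 I3) :
  (0 < p)%N -> aided_le p S #|{: I1 * I2 * I3}|.
Proof.
case: p => // p _; set N := #|_|.
pose z := @enum_val (I1 * I2 * I3)%type xpredT : 'I_N -> _.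
have [A1 A1E] := linear_from_basis (fun i : 'I_N * 'I_1 =>
  (S (z i.1) : F) *: bvec F (z i.1).1.1).
have [A2 A2E] := linear_from_basis (fun i : 'I_N * 'I_p.+1 =>
  ((i.2 == ord0)%:R : F) *: bvec F (z i.1).1.2).
have [A3 A3E] := linear_from_basis (fun i : 'I_N * 'I_p.+1 =>
  ((i.2 == ord0)%:R : F) *: bvec F (z i.1).2).
exists A1, A2, A3; apply/ffunP => y.
rewrite /tmap sum_ffunE.
pose h (i : 'I_N) : ('I_N * 'I_1) * ('I_N * 'I_p.+1) * ('I_N * 'I_p.+1) :=
  ((i, ord0), (i, ord0), (i, ord0)).
pose g (x : ('I_N * 'I_1) * ('I_N * 'I_p.+1) * ('I_N * 'I_p.+1)) := x.1.1.1.
rewrite (bigID (fun x => h (g x) == x)) /= [X in _ + X]big1 ?addr0; last first.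
  move=> [[[i l1] [j l2]] [k l3]]; rewrite /h /g /= !ord1 !xpair_eqE !eqxx /=.
  rewrite !ffunE /= A1E A2E A3E !ffunE /= unit_tensorE mamu11E /=.
  move=> H; case: (eqVneq j i) H => [->|_]; last by rewrite !mul0r scale0r.
  case: (eqVneq k i) => [->|_]; last by rewrite !mul0r scale0r.
  rewrite /= !(eq_sym ord0).
  case: (l2 == ord0); case: (l3 == ord0) => //= _;
    by rewrite !(scale0r, mulr0, mul0r, scaler0).
rewrite (reindex_onto h g) /=; last by move=> x /eqP.
rewrite (eq_bigl xpredT); last by move=> i; rewrite /g /h /= !eqxx.
transitivity (\sum_x (bvec F y x * S x : F)).
  by rewrite bvec_sum.
rewrite (reindex z) /=; last exact: onW_bij (enum_val_bij _).
apply: eq_bigr => i _; rewrite !ffunE /= A1E A2E A3E !ffunE /=.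
rewrite unit_tensorE mamu11E /= !eqxx !scale1r mulr1 /=.
case: (z i) y => [[a b] c] [[a' b'] c'] /=.
rewrite !xpair_eqE (eq_sym a) (eq_sym b) (eq_sym c).
have scE (u v : F) : u *: (v : F^o) = u * v by [].
rewrite scale1r scE mulrC.
by case: (a' == a); case: (b' == b); case: (c' == c);
  rewrite /= ?mulr1 ?mulr0 ?mul0r.
Qed.

Lemma aided_rankP (F : fieldType) (I1 I2 I3 : finType)
    (p : nat) (S : tensor F I1 I2 I3) : (0 < p)%N ->
  aided_le p S (aided_rank p S) /\
  forall r, aided_le p S r -> (aided_rank p S <= r)%N.
Proof.
move=> p_gt0; rewrite /aided_rank; case: pselect => [exr|[]]; last first.
  by eexists; apply/asboolP; exact: aided_le_exists.
case: ex_minnP => m /asboolP m_le m_min; split=> // r r_le.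
by apply: m_min; apply/asboolP.
Qed.

(* Main.v *)
Require Import Defs.
From mathcomp Require Import all_boot all_order all_algebra.
From mathcomp Require Import reals complex.

Set Implicit Arguments.
Unset Strict Implicit.
Unset Printing Implicit Defensive.

Import GRing.Theory.
Local Open Scope ring_scope.

(** Since [<r>] aided by [p] is [\sum_i e_i (x) \sum_l e_(i,l) (x) e_(i,l)], the
    [p]-aided rank of [S] is the least [r] for which [S] is a sum of [r] terms
    [a_i (x) N_i], where [a_i] is a vector of the first factor and [N_i] is a
    matrix of rank at most [p] ([aided_leP]).

    When [p] is at least the dimension of the second factor, every matrix is
    allowed as [N_i], so the slices of [S] along the first factor form such a
    decomposition and the rank is at most the dimension [n] of the first factor
    ([aided_le_card]).  Conversely, contracting the decomposition with a
    functional [x] gives [\sum_i <x, a_i> N_i]; if only [x = 0] contracts [S] to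
    [0], then [x |-> (<x, a_i>)_i] is injective, whence [r >= n]
    ([concise1_card_le]).  This applies to [W^(x)k] ([concise1_W_pow]).

    Suppose [r = n].  The functionals can then be chosen dual to the [a_i], so
    each [N_i] is itself a contraction of [S], and these functionals form a
    basis.  For [W^(x)k] the contraction by [x] is, up to reordering a basis,
    multiplication by an element of the local algebra [(F[e]/(e^2))^(x)k] whose
    constant term is [x_0], the coordinate of [x] at [e_1 (x) ... (x) e_1].  It
    is invertible as soon as [x_0 <> 0] ([slice_W_pow_inj]).  If [p < 2^k], the
    [N_i] are singular, so [x_0 = 0] for all members of a basis of functionals,
    which is absurd ([card_lt_of_nonsingular_slices]). *)

(** * Decompositions with terms of bounded rank *)

Section Decomposition.

Variables (F : fieldType) (I1 I2 I3 : finType) (p : nat).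
Implicit Types (S : tensor F I1 I2 I3) (r : nat).

(** The support of the aided unit tensor is the diagonal [((i,0),(i,l),(i,l))]. *)
Lemma sum_aid_unit r
    (G : ('I_r * 'I_1) * ('I_r * 'I_p) * ('I_r * 'I_p) -> F) :
  \sum_x aid p (unit_tensor F r) x * G x =
  \sum_i \sum_l G ((i, ord0), (i, l), (i, l)).
Proof.
rewrite pair_bigA /=.
pose h (u : 'I_r * 'I_p) : ('I_r * 'I_1) * ('I_r * 'I_p) * ('I_r * 'I_p) :=
  ((u.1, ord0), (u.1, u.2), (u.1, u.2)).
pose g (x : ('I_r * 'I_1) * ('I_r * 'I_p) * ('I_r * 'I_p)) :=
  (x.1.1.1, x.1.2.2).
have off x : ~~ (h (g x) == x) -> aid p (unit_tensor F r) x * G x = 0.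
  case: x => [[[i l1] [j l2]] [k l3]]; rewrite /h /g /= !ord1 !xpair_eqE !eqxx.
  rewrite !ffunE /= unit_tensorE mamu11E /=.
  case: (eqVneq j i) => [->|_]; last by rewrite mul0r mul0r.
  case: (eqVneq k i) => [->|_]; last by rewrite mul0r mul0r.
  by rewrite /= => /negbTE ->; rewrite mulr0 mul0r.
rewrite -(big_rmcond _ _ off).
rewrite (reindex_onto h g); last by move=> x /eqP.
rewrite (eq_bigl xpredT); last by case=> i l; rewrite /g /h /= !eqxx.
apply: eq_bigr => -[i l] _.
by rewrite /h /= !ffunE /= unit_tensorE mamu11E /= !eqxx !mul1r.
Qed.

Lemma aided_leP S r :
  aided_le p S r <->
  exists (a : 'I_r -> I1 -> F) (b : 'I_r -> 'I_p -> I2 -> F)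
         (c : 'I_r -> 'I_p -> I3 -> F),
    forall t y z, S (t, y, z) = \sum_i a i t * \sum_l b i l y * c i l z.
Proof.
have tmapE (A1 : {linear vec F ('I_r * 'I_1)%type -> vec F I1})
           (A2 : {linear vec F ('I_r * 'I_p)%type -> vec F I2})
           (A3 : {linear vec F ('I_r * 'I_p)%type -> vec F I3}) t y z :
    tmap A1 A2 A3 (aid p (unit_tensor F r)) (t, y, z) =
    \sum_i (A1 (bvec F (i, ord0)) t : F) * \sum_l
       (A2 (bvec F (i, l)) y : F) * A3 (bvec F (i, l)) z.
  rewrite /tmap sum_ffunE.
  pose G (x : ('I_r * 'I_1) * ('I_r * 'I_p) * ('I_r * 'I_p)) : F :=
    A1 (bvec F x.1.1) t * A2 (bvec F x.1.2) y * A3 (bvec F x.2) z.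
  transitivity (\sum_x aid p (unit_tensor F r) x * G x).
    by apply: eq_bigr => x _; rewrite !ffunE.
  rewrite sum_aid_unit; apply: eq_bigr => i _; rewrite mulr_sumr.
  by apply: eq_bigr => l _; rewrite /G mulrA.
split=> [[A1 [A2 [A3 ->]]]|[a [b [c Sabc]]]].
  exists (fun i t => A1 (bvec F (i, ord0)) t).
  exists (fun i l y => A2 (bvec F (i, l)) y).
  exists (fun i l z => A3 (bvec F (i, l)) z).
  by move=> t y z; exact: tmapE.
have [A1 A1E] := linear_from_basis (fun i : 'I_r * 'I_1 =>
  [ffun t => a i.1 t] : vec F I1).
have [A2 A2E] := linear_from_basis (fun i : 'I_r * 'I_p =>
  [ffun y => b i.1 i.2 y] : vec F I2).
have [A3 A3E] := linear_from_basis (fun i : 'I_r * 'I_p =>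
  [ffun z => c i.1 i.2 z] : vec F I3).
exists A1, A2, A3; apply/ffunP => -[[t y] z]; rewrite tmapE Sabc.
apply: eq_bigr => i _; rewrite A1E ffunE; congr (_ * _).
by apply: eq_bigr => l _; rewrite A2E A3E !ffunE.
Qed.

(** The slices of [S] along the first factor form a decomposition, and a matrix
    with at most [p] rows has rank at most [p]. *)
Lemma aided_le_card S : (#|I2| <= p)%N -> aided_le p S #|I1|.
Proof.
move=> le_p; apply/aided_leP.
pose e (y : I2) : 'I_p := widen_ord le_p (enum_rank y).
have e_inj : injective e.
  by move=> y y' /(congr1 val) /= /val_inj; exact: enum_rank_inj.
(* [S] is the sum over [t] of [e_t] tensored with its slice at [t], and that
   slice is the sum over its rows [y] of [e_y] tensored with row [y]; [e] embeds
   the rows into the [p] available indices, the remaining ones carrying [0]. *)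
exists (fun i t => (t == enum_val i)%:R), (fun _ l y => (l == e y)%:R).
exists (fun i l z => \sum_(y | e y == l) S (enum_val i, y, z)) => t y z.
rewrite (bigD1 (enum_rank t)) //= [X in _ + X]big1 ?addr0 => [|i it]; last first.
  by rewrite (_ : t == _ = false) ?mul0r //; apply: contraNF it => /eqP ->;
     rewrite enum_valK.
rewrite enum_rankK eqxx mul1r (bigD1 (e y)) //= [X in _ + X]big1 ?addr0 => [|l ly].
  rewrite eqxx mul1r (eq_bigl (pred1 y)) ?big_pred1_eq // => y'.
  exact: (inj_eq e_inj).
by rewrite (negbTE ly) mul0r.
Qed.

(** * Contraction of the first factor *)

Definition slice S (x : I1 -> F) (y : I2) (z : I3) : F :=
  \sum_t x t * S (t, y, z).

(** Conciseness of [S] in its first factor. *)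
Definition concise1 S : Prop :=
  forall x, (forall y z, slice S x y z = 0) -> forall t, x t = 0.

Definition slice_inj S (x : I1 -> F) : Prop :=
  forall v : I2 -> F, (forall z, \sum_y v y * slice S x y z = 0) ->
  forall y, v y = 0.

Section FixedDecomposition.

Variables (S : tensor F I1 I2 I3) (r : nat).
Variables (a : 'I_r -> I1 -> F) (N : 'I_r -> I2 -> I3 -> F).
Hypothesis SE : forall t y z, S (t, y, z) = \sum_i a i t * N i y z.

Let A : 'M[F]_(#|I1|, r) := \matrix_(s, i) a i (enum_val s).
Let x_ (v : 'rV[F]_#|I1|) (t : I1) : F := v 0 (enum_rank t).

Let sliceE v y z : slice S (x_ v) y z = \sum_i (v *m A) 0 i * N i y z.
Proof.
rewrite /slice.
under eq_bigr do rewrite SE mulr_sumr.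
rewrite exchange_big /=; apply: eq_bigr => i _; rewrite mxE mulr_suml.
rewrite (reindex (@enum_val I1 predT)) /=; last exact: onW_bij (enum_val_bij _).
by apply: eq_bigr => s _; rewrite /x_ enum_valK mxE mulrA.
Qed.

Lemma concise1_row_free : concise1 S -> row_free A.
Proof.
move=> conc; apply: inj_row_free => v vA0; apply/rowP => s.
rewrite mxE -(enum_valK s); apply: (conc (x_ v)) => y z.
by rewrite sliceE big1 // => i _; rewrite vA0 mxE mul0r.
Qed.

Lemma concise1_terms_le : concise1 S -> (#|I1| <= r)%N.
Proof. by move=> /concise1_row_free /eqP <-; exact: rank_leq_col. Qed.

(** If [r = #|I1|], then [A] is invertible and row [i] of its inverse is the
    functional contracting [S] to [N i].  The coordinate [t0] vanishes on all
    these rows, so the inverse has a zero column. *)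
Lemma concise1_terms_lt (t0 : I1) :
    concise1 S ->
    (forall x, (exists i, forall y z, slice S x y z = N i y z) -> x t0 = 0) ->
  (#|I1| < r)%N.
Proof.
move=> conc x0; rewrite ltn_neqAle concise1_terms_le // andbT; apply/eqP => card_r.
have Afree := concise1_row_free conc.
have /row_fullP[B BA] : row_full A.
  by rewrite /row_full (eqP Afree) card_r.
have /row_freeP[C AC] := Afree.
have BC : B = C by rewrite -[B]mulmx1 -AC mulmxA BA mul1mx.
have B0 i : B i (enum_rank t0) = 0.
  have := x0 (x_ (row i B)); rewrite /x_ mxE; apply; exists i => y z.
  rewrite sliceE -row_mul BA (bigD1 i) //= !mxE eqxx mul1r.
  by rewrite big1 ?addr0 // => j ji; rewrite !mxE eq_sym (negbTE ji) mul0r.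
have /matrixP/(_ (enum_rank t0) (enum_rank t0)) := AC.
rewrite -BC !mxE eqxx big1 => [/eqP|i _]; last by rewrite B0 mulr0.
by rewrite eq_sym oner_eq0.
Qed.

End FixedDecomposition.

(** Any [v] orthogonal to the [p] vectors [b l] lies in the left kernel of
    [\sum_l b l (x) c l]. *)
Lemma left_kernel_of_small_rank (b : 'I_p -> I2 -> F) (c : 'I_p -> I3 -> F) :
    (p < #|I2|)%N ->
  exists2 v : I2 -> F, exists y, v y != 0
    & forall z, \sum_y v y * (\sum_l b l y * c l z) = 0.
Proof.
move=> p_lt; pose B : 'M[F]_(#|I2|, p) := \matrix_(s, l) b l (enum_val s).
have [K KB /matrix0Pn[i [s Kis]]] :
    exists2 K : 'M_#|I2|, K *m B = 0 & K != 0.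
  exists (kermx B); first exact: mulmx_ker.
  by rewrite kermx_eq0 /row_free neq_ltn (leq_ltn_trans (rank_leq_col B)).
exists (fun y => K i (enum_rank y)).
  by exists (enum_val s); rewrite enum_valK.
move=> z; under eq_bigr do rewrite mulr_sumr.
rewrite exchange_big big1 //= => l _.
under eq_bigr do rewrite mulrA.
rewrite -mulr_suml [X in X * _](_ : _ = 0) ?mul0r //.
have /matrixP/(_ i l) := KB; rewrite !mxE => KBil; rewrite -[RHS]KBil.
rewrite (reindex (@enum_val I2 predT)) /=; last exact: onW_bij (enum_val_bij _).
by apply: eq_bigr => s' _; rewrite enum_valK mxE.
Qed.

Lemma concise1_card_le S r : concise1 S -> aided_le p S r -> (#|I1| <= r)%N.
Proof. by move=> conc /aided_leP[a [b [c SE]]]; exact: concise1_terms_le SE conc. Qed.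

(** If every singular contraction has coordinate [t0] equal to [0], then the
    functionals whose contraction has rank at most [p] span a proper subspace,
    so they contain no basis. *)
Lemma card_lt_of_nonsingular_slices S r (t0 : I1) :
    concise1 S -> (forall x, x t0 != 0 -> slice_inj S x) ->
    (p < #|I2|)%N ->
  aided_le p S r -> (#|I1| < r)%N.
Proof.
move=> conc inj p_lt /aided_leP[a [b [c SE]]].
apply: (concise1_terms_lt SE (t0 := t0)) => // x [i xN].
apply/eqP/negPn/negP => /inj x_inj.
have [v [y /eqP vy] vN] := left_kernel_of_small_rank (b i) (c i) p_lt.
apply: vy; apply: x_inj => z.
by rewrite -[RHS](vN z); apply: eq_bigr => y' _; rewrite xN.
Qed.

End Decomposition.

(** * Slices of the Kronecker powers of [W] *)

Section WPower.

Variable F : fieldType.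

Lemma card_ipow (I : finType) k : #|ipow I k| = (#|I| ^ k)%N.
Proof. by elim: k => [|k IHk] /=; rewrite ?card_unit // card_prod IHk expnS. Qed.

Lemma WE (i j l : 'I_2) : W F (i, j, l) = (i + j + l == 1)%N%:R.
Proof.
rewrite /W !ffunE /=.
by case: i j l => [[|[|i]] //= ?] [[|[|j]] //= ?] [[|[|l]] //= ?];
  rewrite ?(mulr0, mul0r, mulr1, addr0, add0r).
Qed.

Local Notation Wk k := (kron_pow (W F) k).

Lemma sum_I2_pair (J : finType) (f : 'I_2 * J -> F) :
  \sum_u f u = \sum_t f (0, t) + \sum_t f (1, t).
Proof.
transitivity (\sum_i \sum_t f (i, t)).
  by rewrite pair_bigA; apply: eq_bigr => -[].
rewrite !big_ord_recl big_ord0 addr0.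
by have -> : lift ord0 ord0 = 1 :> 'I_2 by exact/val_inj.
Qed.

Lemma I2_cases (i : 'I_2) : i = 0 \/ i = 1.
Proof. by case: i => [[|[|i]] //= ?]; [left|right]; exact/val_inj. Qed.

(** Since [W] is supported on indices of sum [1], the slice of [W^(x)(k+1)] at
    [x] has the block form [[x_2, x_1], [x_1, 0]], where [x_1] and [x_2] stand
    for the slices of [W^(x)k] at the two halves of [x]. *)
Lemma slice_W_powS k (x : ipow 'I_2 k.+1 -> F) (j l : 'I_2) y z :
  slice (Wk k.+1) x (j, y) (l, z) =
  if (j + l == 0)%N then slice (Wk k) (fun t => x (1, t)) y z
  else if (j + l == 1)%N then slice (Wk k) (fun t => x (0, t)) y z else 0.
Proof.
have E i : \sum_t x (i, t) * kron (W F) (Wk k) ((i, t), (j, y), (l, z)) =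
           W F (i, j, l) * slice (Wk k) (fun t => x (i, t)) y z.
  by rewrite /slice mulr_sumr; apply: eq_bigr => t _; rewrite !ffunE mulrCA.
rewrite [LHS]sum_I2_pair !E !WE /=.
by case: j l {E} => [[|[|j]] //= ?] [[|[|l]] //= ?];
  rewrite ?(mul0r, mul1r, addr0, add0r).
Qed.

(** Both halves of [x] occur as blocks of the slice at [x]. *)
Lemma concise1_W_pow k : concise1 (Wk k).
Proof.
elim: k => [|k IHk] x x0.
  move=> []; have := x0 tt tt; rewrite /slice (big_pred1 tt) => [|[]//].
  by rewrite !ffunE /= !mulr1.
move=> [i t]; have [->|->] := I2_cases i.
  by apply: (IHk (fun t => x (0, t))) => y z; have := x0 (0, y) (1, z);
    rewrite slice_W_powS.
by apply: (IHk (fun t => x (1, t))) => y z; have := x0 (0, y) (0, z);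
   rewrite slice_W_powS.
Qed.

Fixpoint ipow0 k : ipow 'I_2 k :=
  if k is k'.+1 then (0, ipow0 k') else tt.

(** By the block form of [slice_W_powS], a kernel vector [(v_1, v_2)] satisfies [v_1 x_1 = 0], so
    [v_1 = 0] by induction, and then [v_2 x_1 = 0], so [v_2 = 0] as well. *)
Lemma slice_W_pow_inj k (x : ipow 'I_2 k -> F) :
  x (ipow0 k) != 0 -> slice_inj (Wk k) x.
Proof.
elim: k x => [|k IHk] x x0 v vx.
  move=> []; have := vx tt; rewrite /slice !(big_pred1 tt) => [|[]//|[]//].
  rewrite !ffunE /= !mulr1 => /eqP; rewrite mulf_eq0 (negbTE x0) orbF.
  by move/eqP.
have inj0 := IHk (fun t => x (0, t)) x0.
have sumE l z : \sum_y v (0, y) * slice (Wk k.+1) x (0, y) (l, z) +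
    \sum_y v (1, y) * slice (Wk k.+1) x (1, y) (l, z) = 0.
  by rewrite -[RHS](vx (l, z)) [RHS]sum_I2_pair.
have v0 : forall y, v (0, y) = 0.
  apply: inj0 => z; rewrite -[RHS](sumE 1 z).
  rewrite [X in _ = _ + X]big1 ?addr0 => [|y _].
    by apply: eq_bigr => y _; rewrite slice_W_powS.
  by rewrite slice_W_powS mulr0.
have v1 : forall y, v (1, y) = 0.
  apply: inj0 => z; rewrite -[RHS](sumE 0 z).
  rewrite [X in _ = X + _]big1 ?add0r => [|y _]; last by rewrite v0 mul0r.
  by apply: eq_bigr => y _; rewrite slice_W_powS.
by move=> [j y]; have [->|->] := I2_cases j.
Qed.

End WPower.

Theorem proposition4p12 (R : realType) (k p : nat)
    (hk : (1 <= k)%N) (hp : (1 <= p)%N) :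
  ((2 ^ k <= p)%N -> aided_rank p (kron_pow (W R[i]%C) k) = (2 ^ k)%N) /\
  ((p < 2 ^ k)%N -> (2 ^ k < aided_rank p (kron_pow (W R[i]%C) k))%N).
Proof.
have [le_rank rank_min] := aided_rankP (kron_pow (W R[i]%C) k) hp.
have card_k : #|ipow 'I_2 k| = (2 ^ k)%N by rewrite card_ipow card_ord.
have conc := @concise1_W_pow R[i]%C k.
rewrite -card_k; split=> cmp_p.
  apply/eqP; rewrite eqn_leq (concise1_card_le conc le_rank) andbT.
  exact: rank_min (aided_le_card _ cmp_p).
apply: card_lt_of_nonsingular_slices conc _ cmp_p le_rank.
exact: slice_W_pow_inj.
Qed.
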